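(* In the array $\mathcal{S}$ of $m$-by-$n$ nodes, consider the detection problem $$\mathbb{H}_0:\ X(i,j)\sim N(0,1)\ \text{i.i.d. for all }(i,j)\in\mathcal{S}$$ versus $$\mathbb{H}_1:\ X(i,j)\sim \mu+N(0,1)\ \text{ for }(i,j)\in\mathcal{L}^0_n,\qquad X(i,j)\sim N(0,1)\ \text{ for }(i,j)\in\mathcal{S}\setminus\mathcal{L}^0_n,\ \text{ all independent},$$ for some $\mathcal{L}^0_n\in\mathcal{F}_n$ with $|\mathcal{L}^0_n|\geq\zeta_1 n^{\alpha}$ and some $\mu>0$, where $\mathcal{L}^0_n$ is a chain with good continuation whose length is of the order $O(\zeta_1 n^{\alpha})$ for some $\zeta_1>0$ and $0<\alpha\leq 1$. Let $p_1=\mathbb{P}(N(\mu,1)>x^{\ast})$. If $\mu$ is such that $$p_1>\rho^{\alpha\log(\zeta_1 n)/((1+\epsilon)\log n)}\ \longrightarrow\ \rho^{\alpha/(1+\epsilon)}\quad\text{as } n\rightarrow\infty$$ for some small $\epsilon>0$, then as $n\rightarrow\infty$, $$\mathbb{P}\left(|L_0(n)|>(1+\epsilon/2)\log_{1/\rho}n\ \big|\ \mathbb{H}_1\right)\rightarrow 1.$$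
   Context: Fix positive integers $m$ (number of rows) and $C$; $n$ is the number of columns. Let $\mathcal{S}=\{(i,j):1\leq i\leq m,\ 1\leq j\leq n\}$, where $(i,j)$ is the node in row $i$ and column $j$, and let $X(i,j)$ be a random variable attached to each node. A chain with good continuation is a subset of $\mathcal{S}$ of the form $\mathcal{L}=\{(i_0,j),(i_1,j+1),\ldots,(i_L,j+L)\}$ with $L\ge 0$ and $|i_k-i_{k-1}|\leq C$ for $1\leq k\leq L$; its length is $|\mathcal{L}|=L+1$. Let $\mathcal{F}_n$ be the set of all chains with good continuation in $\mathcal{S}$. Fix a threshold $x^{\ast}\in\mathbb{R}$ and let $p=\mathbb{P}(N(0,1)>x^{\ast})$. A node $(i,j)$ is significant if $X(i,j)>x^{\ast}$; a chain is significant if all its nodes are significant. $L_0(n)$ denotes a longest significant chain in $\mathcal{S}$ and $|L_0(n)|$ its length. The constant $\rho=\rho(m,C,p)\in(0,1)$ is defined as follows: let $P_n$ be the probability, when all nodes are independently significant with probability $p$ in an array with exactly $n$ columns, that there is a significant chain of length $n$ (i.e. traversing all columns); it is known that $\rho=\lim_{n\to\infty}P_n/P_{n-1}$ exists, lies in $(0,1)$ and depends only on $m,C,p$. *)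

(* Defs.v *)
From HB Require Import structures.
From mathcomp Require Import all_boot all_order all_algebra.
From mathcomp Require Import all_classical all_reals all_analysis.
Import Order.TTheory GRing.Theory Num.Theory.
Import numFieldNormedType.Exports.

Set Implicit Arguments.
Unset Strict Implicit.
Unset Printing Implicit Defensive.

Local Open Scope ring_scope.

(* Rows and columns are numbered from 0: the node (i, j) : 'I_m * 'I_n stands
   for the node in row i + 1 and column j + 1. *)
Definition chain_step (m n C : nat) : rel ('I_m * 'I_n) :=
  fun u v => (v.2 == u.2.+1 :> nat) && (`|(v.1 : nat) - (u.1 : nat)| <= C)%N.

(* A chain with good continuation is a set of nodes, enumerated column by
   column by the nonempty sequence u :: s; its length is its cardinal. *)
Definition good_chain (m n C : nat) (A : {set 'I_m * 'I_n}) : Prop :=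
  exists u s, path (@chain_step m n C) u s /\ A =i u :: s.

(* |L_0(n)| when S is the set of significant nodes; it is 0 if S is empty. *)
Definition longest_chain (m n C : nat) (S : {set 'I_m * 'I_n}) : nat :=
  \max_(A : {set 'I_m * 'I_n} | `[< good_chain C A >] && (A \subset S)) #|A|.

(* P_n: S ranges over the possible sets of significant nodes of an array with n
   columns, weighted by the product of m * n Bernoulli(p) laws. *)
Definition crossing_prob (R : realType) (m C : nat) (p : R) (n : nat) : R :=
  \sum_(S : {set 'I_m * 'I_n} |
        [exists A : {set 'I_m * 'I_n},
           [&& `[< good_chain C A >], A \subset S & #|A| == n]])
    p ^+ #|S| * (1 - p) ^+ #|~: S|.

(* P(N(mu, 1) > x) *)
Definition normal_tail (R : realType) (mu x : R) : R :=
  fine (normal_prob mu 1 [set y | x < y]%classic).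

Definition significant (R : realType) (d : measure_display)
    (T : measurableType d) (m n : nat) (X : 'I_m * 'I_n -> T -> R) (x : R)
    (t : T) : {set 'I_m * 'I_n} :=
  [set u | x < X u t]%SET.

Definition mutually_independent (R : realType) (d : measure_display)
    (T : measurableType d) (P : probability T R) (I : finType)
    (X : I -> {RV P >-> R}) : Prop :=
  forall (J : {set I}) (B : I -> set R), (forall i, measurable (B i)) ->
    P (\bigcap_(i in [set` J]) (X i @^-1` B i))%classic =
    (\prod_(i in J) P (X i @^-1` B i)%classic)%E.

(* The law of the array X under H_1, with elevated mean mu on the chain L. *)
Definition alternative (R : realType) (d : measure_display)
    (T : measurableType d) (P : probability T R) (m n : nat) (mu : R)
    (L : {set 'I_m * 'I_n}) (X : 'I_m * 'I_n -> {RV P >-> R}) : Prop :=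
  mutually_independent X /\
  forall u (B : set R), measurable B ->
    distribution P (X u) B = normal_prob (if u \in L then mu else 0) 1 B.

(* Main.v *)
Require Import Defs.
From HB Require Import structures.
From mathcomp Require Import all_boot all_order all_algebra.
From mathcomp Require Import all_classical all_reals all_analysis.
From mathcomp Require Import ring lra.
Import Order.TTheory GRing.Theory Num.Theory.
Import numFieldNormedType.Exports.

(** Under the alternative, the nodes of [L n] are significant independently of
    each other, with probability [q = normal_tail mu xstar]. Cut [L n], which
    has at least [zeta1 * n `^ alpha] nodes, into disjoint consecutive blocks of
    [k] nodes (chain_blocks), where [k] is the least integer above
    [c * ln n]. Each block is a chain, so as soon as one of them is entirely
    significant the longest significant chain has more than [c * ln n] nodes.
    The blocks are independent and each is significant with probability
    [q ^+ k] (prob_no_block, longest_chain_lower_bound), so the probability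
    that none of them is significant is at most [expR (- N * q ^+ k)] with [N]
    blocks, and [N * q ^+ k] is at least of order
    [n `^ (alpha + c * ln q) / ln n]. It tends to infinity as soon as
    [0 < alpha + c * ln q] (no_block_cvg0, longest_chain_gt_log).

    For [0 < rho < 1], take [c = (1 + eps / 2) / ln rho^-1]. The first half of
    the theorem turns the hypothesis on [q] into [rho `^ (alpha / (1 + eps)) <=
    q], hence [- c * ln q <= alpha * (1 + eps / 2) / (1 + eps) < alpha]. For
    the other values of [rho] the threshold in the theorem is nonpositive for
    [n] positive, by the conventions on [ln] and division, and [c = 0]
    suffices. Positivity of [q] comes from that of powers. *)

Local Open Scope classical_set_scope.
Local Open Scope ring_scope.

Set Implicit Arguments.
Unset Strict Implicit.

(** * Chains and their blocks *)

Lemma chain_uniq (m n C : nat) (w : seq ('I_m * 'I_n)) :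
  sorted (@chain_step m n C) w -> uniq w.
Proof.
move=> sw; apply: (@map_uniq _ _ (fun u : 'I_m * 'I_n => u.2 : nat)).
apply: (sorted_uniq ltn_trans ltnn); rewrite sorted_map.
by apply: sub_sorted sw => u v /andP[/eqP uv _]; rewrite /= uv.
Qed.

(** A chain of at least [N * k] nodes contains [N] pairwise disjoint chains of
    exactly [k] nodes: cut it into consecutive pieces. *)
Lemma chain_blocks (m n C k N : nat) (w : seq ('I_m * 'I_n)) :
  (0 < k)%N -> sorted (@chain_step m n C) w -> (N * k <= size w)%N ->
  exists bs : seq {set 'I_m * 'I_n},
    [/\ size bs = N,
        forall b, b \in bs ->
          [/\ good_chain C b, #|b| = k & b \subset [set x in w]%SET]
      & pairwise (fun A B : {set 'I_m * 'I_n} => [disjoint A & B]%B) bs].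
Proof.
move=> k_gt0; elim: N w => [|N IHN] w sw Nw; first by exists [::].
have := chain_uniq sw; rewrite -(cat_take_drop k w) cat_uniq.
move=> /and3P[utake /hasPn tdP _].
have ktake : size (take k w) = k.
  by rewrite size_takel //; apply: leq_trans Nw; rewrite mulSn leq_addr.
have [|bs [sbs bsP bs_disj]] := IHN (drop k w) (drop_sorted k sw).
  rewrite size_drop leq_subRL -?mulSn //.
  by apply: leq_trans Nw; rewrite mulSn leq_addr.
exists ([set x in take k w]%SET :: bs); split=> [|b|/=].
- by rewrite /= sbs.
- rewrite cat_take_drop inE => /predU1P[->|/bsP[gb cb bw]].
    split; last by apply/fintype.subsetP => x; rewrite !inE => /mem_take.
      have := take_sorted k sw; move: ktake.
      case: (take k w) => [k0|u s _ us]; first by rewrite -k0 in k_gt0.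
      by exists u, s; split=> // x; rewrite inE.
    by rewrite cardsE (card_uniqP utake).
  split=> //; apply: fintype.subset_trans bw _; apply/fintype.subsetP => x.
  by rewrite !inE => /mem_drop.
- rewrite bs_disj andbT; apply/allP => b /bsP[_ _ /fintype.subsetP bw].
  rewrite disjoint_sym; apply/pred0P => x /=; apply/negP => /andP[/bw].
  by rewrite !inE => /tdP /negP.
Qed.

Lemma longest_chain_ge (m n C : nat) (S b : {set 'I_m * 'I_n}) :
  good_chain C b -> b \subset S -> (#|b| <= longest_chain C S)%N.
Proof.
by move=> gb bS; apply: leq_bigmax_cond; rewrite bS andbT; apply/asboolP.
Qed.

(** * Independent blocks *)

(** Given events [G i] that multiply over the subfamilies of [L], each of
    probability [q], and pairwise disjoint blocks [b] of size [k] in [L], the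
    events that some [G i] with [i] in [b] fails multiply as well. The
    statement carries a further conjunction of [G i] over a set [J] disjoint
    from the blocks, so that induction on the blocks only needs
    P(A and not B) = P(A) - P(A and B): both terms on the right are instances
    of the induction hypothesis, for [J] and for [J] enlarged by one block. *)
Lemma prob_no_block (R : realType) (d : measure_display) (T : measurableType d)
    (P : probability T R) (I : finType) (G : I -> set T) (q : R) (k : nat)
    (L : {set I}) :
  (forall i, measurable (G i)) ->
  (forall J : {set I}, J \subset L ->
     P (\bigcap_(i in [set` J]) G i) = (q ^+ #|J|)%:E) ->
  forall (bs : seq {set I}) (J : {set I}), J \subset L ->
  (forall b, b \in bs -> [/\ b \subset L, #|b| = k & [disjoint J & b]%B]) ->
  pairwise (fun A B : {set I} => [disjoint A & B]%B) bs ->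
  P (\bigcap_(i in [set` J]) G i `&`
     \bigcap_(b in [set` bs]) ~` (\bigcap_(i in [set` b]) G i)) =
  (q ^+ #|J| * (1 - q ^+ k) ^+ size bs)%:E.
Proof.
move=> mG PG; have mcap (J : {set I}) : measurable (\bigcap_(i in [set` J]) G i).
  by apply: fin_bigcap_measurable => // i _; exact: mG.
have mrest (bs : seq {set I}) :
    measurable (\bigcap_(b in [set` bs]) ~` (\bigcap_(i in [set` b]) G i)).
  by apply: fin_bigcap_measurable => // b _; apply: measurableC.
elim=> [|b bs IH] J JL bsP /=.
  by rewrite set_nil bigcap_set0 setIT PG // mulr1.
move=> /andP[/allP bbs bs_disj].
have [bL bk Jb] := bsP b (mem_head _ _).
have bsP' b' : b' \in bs -> [/\ b' \subset L, #|b'| = k & [disjoint J & b']%B].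
  by move=> b'bs; apply: bsP; rewrite inE b'bs orbT.
have -> : [set` b :: bs] = b |` [set` bs].
  by apply/seteqP; split => x /=; rewrite inE => /predU1P.
rewrite bigcap_setU1.
set A := \bigcap_(i in _) G i; set B := \bigcap_(i in [set` b]) G i.
set D := \bigcap_(i in [set` bs]) _.
have -> : A `&` (~` B `&` D) = (A `&` D) `\` B by rewrite setIA setIAC setDE.
have mAD : measurable (A `&` D) by apply: measurableI; [exact: mcap|exact: mrest].
have -> : P ((A `&` D) `\` B) = (P (A `&` D) - P (A `&` D `&` B))%E.
  apply: measureD => //; first exact: mcap.
  by rewrite (le_lt_trans (probability_le1 P mAD)) // ltry.
have -> : A `&` D `&` B = \bigcap_(i in [set` J :|: b]) G i `&` D.
  rewrite setIAC; congr (_ `&` _); rewrite -bigcap_setU.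
  congr (\bigcap_(i in _) G i); apply/seteqP.
  by split => i /=; rewrite inE => /orP.
rewrite /A /D (IH _ JL bsP' bs_disj) (IH (J :|: b)) //.
- rewrite cardsU disjoint_setI0 // cards0 subn0 bk -EFinB exprD exprS.
  by congr EFin; ring.
- by rewrite finset.subUset JL.
- move=> b' b'bs; have [b'L b'k Jb'] := bsP' _ b'bs; split=> //.
  rewrite -finset.setI_eq0 finset.setIUl !disjoint_setI0 ?finset.setU0 //.
  exact: bbs.
Qed.

Lemma measurable_ray (R : realType) (x : R) :
  measurable ([set y | x < y] : set R).
Proof. by rewrite -set_itvoy; exact: measurable_itv. Qed.

(** There are finitely many possible sets of significant nodes, so every
    property of that set defines an event. *)
Lemma measurable_significant (R : realType) (d : measure_display)
    (T : measurableType d) (P : probability T R) (m n : nat)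
    (X : 'I_m * 'I_n -> {RV P >-> R}) (x : R)
    (Q : {set 'I_m * 'I_n} -> Prop) :
  measurable [set t | Q (significant X x t)].
Proof.
have mX u : measurable [set t | x < X u t].
  rewrite -[X in measurable X]setTI.
  exact: (measurable_funP (X u) measurableT _ (measurable_ray x)).
have -> : [set t | Q (significant X x t)] =
    \bigcup_(S in [set S | Q S]) \bigcap_(u in setT)
      (if u \in S then [set t | x < X u t] else ~` [set t | x < X u t]).
  apply/seteqP; split=> [t Qt|t [S /= QS St]].
    exists (significant X x t) => // u _.
    by rewrite inE; case: ifPn => // /negP.
  have -> // : significant X x t = S.
  apply/setP => u; rewrite inE.
  by have := St u I; case: ifPn => //= _ /negP/negbTE.
apply: fin_bigcup_measurable => [|S _]; first exact: finite_finset.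
apply: fin_bigcap_measurable => [|u _]; first exact: finite_finset.
by case: ifP => _; [exact: mX|apply: measurableC; exact: mX].
Qed.

Lemma normal_tailE (R : realType) (mu x : R) :
  normal_prob mu 1 [set y | x < y] = (normal_tail mu x)%:E.
Proof.
by rewrite /normal_tail fineK // fin_num_measure //; exact: measurable_ray.
Qed.

Lemma normal_tail_le1 (R : realType) (mu x : R) : normal_tail mu x <= 1.
Proof.
by rewrite -lee_fin -normal_tailE probability_le1 //; exact: measurable_ray.
Qed.

(** If none of the [N] blocks of size [k] cut out of [L] were significant,
    [N] independent events of probability [1 - normal_tail mu x ^+ k] would
    occur. *)
Lemma longest_chain_lower_bound (R : realType) (d : measure_display)
    (T : measurableType d) (P : probability T R) (m n C k N : nat) (mu x : R)
    (L : {set 'I_m * 'I_n}) (X : 'I_m * 'I_n -> {RV P >-> R}) :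
  good_chain C L -> alternative mu L X -> (0 < k)%N -> (N * k <= #|L|)%N ->
  ((1 - (1 - normal_tail mu x ^+ k) ^+ N)%:E <=
     P [set t | (k <= longest_chain C (significant X x t))%N])%E.
Proof.
move=> [u [s [us Lus]]] [indX distX] k_gt0 NkL.
have sizeL : #|L| = size (u :: s).
  by rewrite (eq_card Lus) (card_uniqP (@chain_uniq _ _ _ (u :: s) us)).
rewrite sizeL in NkL.
have [bs [<- bsP bs_disj]] := @chain_blocks _ _ _ _ _ (u :: s) k_gt0 us NkL.
have LE : [set v in u :: s]%SET = L by apply/setP => v; rewrite inE Lus.
pose G v := X v @^-1` [set y | x < y].
have mray := measurable_ray x.
have mG v : measurable (G v).
  by rewrite /G -[X in measurable X]setTI; exact: measurable_funP.
have PG (J : {set 'I_m * 'I_n}) : J \subset L ->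
    P (\bigcap_(v in [set` J]) G v) = (normal_tail mu x ^+ #|J|)%:E.
  move=> /fintype.subsetP JL; rewrite (indX J (fun=> [set y | x < y])) //.
  rewrite (eq_bigr (fun=> (normal_tail mu x)%:E)) => [|v vJ].
    by rewrite prodEFin prodr_const.
  by have := distX v _ mray; rewrite (JL _ vJ) normal_tailE.
have := @prob_no_block _ _ _ P _ G (normal_tail mu x) k L mG PG bs finset.set0.
rewrite finset.sub0set => /(_ isT); rewrite cards0 expr0 mul1r.
set E := (X in P X) => PE.
have mE : measurable E.
  apply: measurableI; apply: fin_bigcap_measurable => // b _.
  by apply: measurableC; apply: fin_bigcap_measurable => // i _; exact: mG.
rewrite EFinB -PE //; last first.
  move=> b /bsP[_ bk bL]; split=> //; first by rewrite -LE.
  by rewrite -finset.setI_eq0 finset.set0I.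
rewrite -probability_setC //; apply: le_measure; rewrite ?inE.
- exact: measurableC.
- exact: (measurable_significant X x (fun S => (k <= longest_chain C S)%N)).
move=> t Et /=; rewrite leqNgt; apply/negP => lek; apply: Et.
split=> [v|b /= bbs Gb].
  by rewrite /= inE.
have [gb bk _] := bsP b bbs; move: lek; rewrite -bk ltnNge => /negP; apply.
apply: longest_chain_ge => //; apply/fintype.subsetP => v vb; rewrite inE.
exact: Gb.
Qed.

(** * Asymptotics of the number of blocks *)

Lemma ln_nat_cvgy (R : realType) : ln (n%:R : R) @[n --> \oo] --> +oo.
Proof.
apply/cvgryPge => A; near=> n.
rewrite -(expRK A) ler_ln ?posrE ?expR_gt0 //; near: n.
  exact: (cvgry_ge cvgr_idn).
exact: (cvgry_gt cvgr_idn).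
Unshelve. all: by end_near. Qed.

(** With [y] for [ln n], the expected number of significant blocks of size [k]
    in a chain of [l] nodes grows at least linearly in [y]. Up to constants it
    is [expR (delta * y) / (c * y + 1)], and the square in
    [(1 + delta / 2 * y) ^+ 2 <= expR (delta * y)] leaves one factor
    [1 + delta / 2 * y] after [c * y + 1] is absorbed. *)
Lemma expected_blocks_lower_bound (R : realType) (zeta alpha c q y delta : R)
    (l k : nat) :
  delta = alpha + c * ln q -> 0 < delta ->
  0 < zeta -> 0 <= c -> 0 < q -> q <= 1 -> 0 <= y ->
  zeta * expR (alpha * y) <= l%:R -> (0 < k)%N -> k%:R <= c * y + 1 ->
  zeta * q / (1 + 2 * c / delta) * (1 + delta / 2 * y) - 1
    <= (l %/ k)%N%:R * q ^+ k.
Proof.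
move=> deltaE delta_gt0 zeta_gt0 c_ge0 q_gt0 q_le1 y_ge0 zl k_gt0 kcy.
have kR_gt0 : (0 : R) < k%:R by rewrite ltr0n.
have lnq : ln q <= 0 by exact: ln_le0.
have qk_gt0 : 0 < q ^+ k by exact: exprn_gt0.
have qk_le1 : q ^+ k <= 1 by apply: exprn_ile1 => //; exact: ltW.
have w_gt0 : 0 < c * y + 1 by rewrite ltr_wpDl ?mulr_ge0.
(* The quotient is rounded down, which costs at most one block. *)
have quot : l%:R / k%:R - 1 <= (l %/ k)%N%:R :> R.
  rewrite lerBlDr ler_pdivrMr // natr1 -natrM ler_nat.
  by apply: ltnW; exact: ltn_ceil.
have qk_ge : q * expR (c * ln q * y) <= q ^+ k.
  rewrite -[X in X * _](lnK q_gt0) -[X in X ^+ _](lnK q_gt0) -expRD -expRM_natl.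
  by rewrite ler_expR; have := ler_wnM2r lnq kcy; lra.
have lk_ge : zeta * expR (alpha * y) / (c * y + 1) <= l%:R / k%:R.
  apply: ler_pM => //; first by rewrite mulr_ge0 ?expR_ge0 // ltW.
    by rewrite invr_ge0 ltW.
  by rewrite lef_pV2 ?posrE.
set t := 1 + delta / 2 * y; set K := 1 + 2 * c / delta.
have t_ge1 : 1 <= t by rewrite lerDl mulr_ge0 // divr_ge0 // ltW.
have K_gt0 : 0 < K by rewrite ltr_wpDr // divr_ge0 ?mulr_ge0 // ltW.
have tt : t ^+ 2 <= expR (delta * y).
  rewrite (_ : delta * y = 2%:R * (delta / 2 * y)); last by field.
  by rewrite expRM_natl lerXn2r ?nnegrE ?expR_ge0 ?expR_ge1Dx // (le_trans ler01).
have wKt : c * y + 1 <= K * t.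
  have -> : K * t = 1 + delta / 2 * y + 2 * c / delta + c * y.
    by rewrite /K /t; field; rewrite gt_eqF.
  have : 0 <= delta / 2 * y by rewrite mulr_ge0 // divr_ge0 // ltW.
  have : 0 <= 2 * c / delta by rewrite divr_ge0 ?mulr_ge0 // ltW.
  by lra.
have tK : t / K <= expR (delta * y) / (c * y + 1).
  rewrite ler_pdivrMr // mulrAC ler_pdivlMr //.
  apply: (@le_trans _ _ (t ^+ 2 * K)); last by rewrite ler_wpM2r // ltW.
  by rewrite expr2 -mulrA ler_wpM2l ?(le_trans ler01) // (mulrC t).
apply: (@le_trans _ _ ((l%:R / k%:R - 1) * q ^+ k)); last first.
  by rewrite ler_wpM2r // ltW.
rewrite mulrBl mul1r lerB //.
apply: (@le_trans _ _ (zeta * expR (alpha * y) / (c * y + 1) *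
                        (q * expR (c * ln q * y)))); last first.
  by rewrite ler_pM // ?mulr_ge0 ?invr_ge0 ?expR_ge0 ?(ltW zeta_gt0)
    ?(ltW w_gt0) ?(ltW q_gt0).
have -> : zeta * expR (alpha * y) / (c * y + 1) * (q * expR (c * ln q * y)) =
          zeta * q * (expR (delta * y) / (c * y + 1)).
  by rewrite deltaE [(alpha + _) * y]mulrDl expRD; ring.
rewrite -mulrA [K^-1 * _]mulrC; apply: ler_wpM2l => //.
by rewrite mulr_ge0 // ltW.
Qed.

Lemma no_block_cvg0 (R : realType) (zeta alpha c q : R) (l : nat -> nat) :
  0 < zeta -> 0 <= c -> 0 < q -> q <= 1 -> 0 < alpha + c * ln q ->
  (\forall n \near \oo, zeta * n%:R `^ alpha <= (l n)%:R) ->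
  let k n := (Num.truncn (c * ln (n%:R : R))).+1 in
  (1 - q ^+ k n) ^+ (l n %/ k n) @[n --> \oo] --> (0 : R).
Proof.
move=> zeta_gt0 c_ge0 q_gt0 q_le1 delta_gt0 zl k.
pose delta := alpha + c * ln q.
pose a := zeta * q / (1 + 2 * c / delta).
pose f n : R := a * (1 + delta / 2 * ln n%:R) - 1.
have a_gt0 : 0 < a.
  apply: divr_gt0; first exact: mulr_gt0.
  by rewrite ltr_wpDr // divr_ge0 ?mulr_ge0 // ltW.
have fy : f n @[n --> \oo] --> +oo.
  apply/cvgryPge => A; near=> n.
  have lnn : (A + 1) / (a * (delta / 2)) <= ln n%:R.
    by near: n; exact: (cvgry_ge (@ln_nat_cvgy R)).
  rewrite /f; rewrite ler_pdivrMr in lnn; last by rewrite mulr_gt0 // divr_gt0.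
  rewrite (_ : a * _ = a + ln n%:R * (a * (delta / 2))); last by ring.
  by lra.
have ub : expR (- f n) @[n --> \oo] --> (0 : R).
  exact: (cvg_comp _ _ fy (@cvgr_expR R)).
apply: squeeze_cvgr (cvg_cst 0) ub; near=> n.
have n_gt1 : (1 < n)%N by near: n; exact: nbhs_infty_gt.
have lnn : 0 <= ln (n%:R : R) by rewrite ln_ge0 // ler1n ltnW.
have nR : (n%:R == 0 :> R) = false by rewrite pnatr_eq0; case: (n) n_gt1.
have qk_le1 : q ^+ k n <= 1 by apply: exprn_ile1 => //; exact: ltW.
rewrite exprn_ge0 ?subr_ge0 //=.
apply: (@le_trans _ _ (expR (- q ^+ k n) ^+ (l n %/ k n))).
  by rewrite lerXn2r ?nnegrE ?subr_ge0 ?expR_ge0 ?expR_ge1Dx.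
rewrite -expRM_natl ler_expR mulrN lerN2.
apply: expected_blocks_lower_bound => //.
  have : zeta * n%:R `^ alpha <= (l n)%:R by near: n.
  by rewrite /powR nR.
rewrite /k -natr1 lerD2r.
by have /andP[] := truncn_itv (mulr_ge0 c_ge0 lnn).
Unshelve. all: by end_near. Qed.

(** * Detection of long chains *)

(** Blocks have [k] nodes, the least integer above [c * ln n], and [q ^+ k] is
    of order [n `^ (c * ln q)] for [q = normal_tail mu x]. The condition on
    [alpha + c * ln q] thus makes the number of blocks, of order at least
    [n `^ alpha / ln n], exceed [q ^- k] by a positive power of [n] up to a
    logarithm. *)
Lemma longest_chain_gt_log (R : realType) (m C : nat) (x mu zeta alpha c : R)
    (L : forall n : nat, {set 'I_m * 'I_n})
    (d : nat -> measure_display) (T : forall n : nat, measurableType (d n))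
    (P : forall n : nat, probability (T n) R)
    (X : forall n : nat, 'I_m * 'I_n -> {RV (P n) >-> R}) :
  0 < zeta -> 0 <= c -> 0 < normal_tail mu x ->
  0 < alpha + c * ln (normal_tail mu x) ->
  (forall n : nat, (0 < n)%N -> good_chain C (L n)) ->
  (\forall n \near \oo, zeta * n%:R `^ alpha <= #|L n|%:R) ->
  (forall n : nat, (0 < n)%N -> alternative mu (L n) (X n)) ->
  P n [set t | c * ln n%:R < (longest_chain C (significant (X n) x t))%:R]
    @[n --> \oo] --> 1%E.
Proof.
move=> zeta_gt0 c_ge0 q_gt0 delta_gt0 gL zL altX.
have q_le1 := normal_tail_le1 mu x.
set q := normal_tail mu x in q_gt0 q_le1 delta_gt0.
pose k n := (Num.truncn (c * ln (n%:R : R))).+1.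
pose f n : R := (1 - q ^+ k n) ^+ (#|L n| %/ k n).
have f0 : f n @[n --> \oo] --> 0.
  exact: no_block_cvg0 zeta_gt0 c_ge0 q_gt0 q_le1 delta_gt0 zL.
have lb : (1 - f n)%:E @[n --> \oo] --> (1%E : \bar R).
  apply: cvg_EFin; first by near=> n.
  rewrite -[X in _ --> X]subr0; exact: cvgB (cvg_cst _) f0.
apply: squeeze_cvge lb (cvg_cst 1%E); near=> n.
have n_gt0 : (0 < n)%N by near: n; exact: nbhs_infty_gt.
have mE := measurable_significant (X n) x.
apply/andP; split; last first.
  apply: probability_le1.
  exact: (mE (fun S => c * ln n%:R < (longest_chain C S)%:R)).
have kL : (#|L n| %/ k n * k n <= #|L n|)%N by exact: leq_divM.
have k_gt0 : (0 < k n)%N by [].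
have := longest_chain_lower_bound x (gL n n_gt0) (altX n n_gt0) k_gt0 kL.
move=> /le_trans; apply.
apply: le_measure; rewrite ?inE.
- exact: (mE (fun S => (k n <= longest_chain C S)%N)).
- exact: (mE (fun S => c * ln n%:R < (longest_chain C S)%:R)).
move=> t /= kt; apply: (@lt_le_trans _ _ (k n)%:R); last by rewrite ler_nat.
exact: truncnS_gt.
Unshelve. all: by end_near. Qed.

(** The base [a] is arbitrary, although [a `^ y] is discontinuous in [y] at
    [0] when [a = 0]: the limit [l] of the exponents is positive. *)
Lemma cvg_powR_exponent (R : realType) (a l : R) (g : nat -> R) :
  0 < l -> g n @[n --> \oo] --> l -> a `^ g n @[n --> \oo] --> a `^ l.
Proof.
move=> l_gt0 gl; have [->|a_neq0] := eqVneq a 0.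
  rewrite powR0 ?gt_eqF //; apply: cvg_near_cst.
  near=> n; rewrite powR0 // gt_eqF //; near: n.
  exact: cvgr_gt gl _ l_gt0.
rewrite /powR (negPf a_neq0).
have gla : g n * ln a @[n --> \oo] --> l * ln a.
  by apply: cvgM gl _; exact: cvg_cst.
exact: (cvg_comp _ _ gla (@continuous_expR R _)).
Unshelve. all: by end_near. Qed.

Lemma log_ratio_cvg (R : realType) (zeta alpha b : R) :
  0 < zeta ->
  alpha * ln (zeta * n%:R) / (b * ln n%:R) @[n --> \oo] --> alpha / b.
Proof.
move=> zeta_gt0.
have : alpha / b * (ln zeta / ln (n%:R) + 1) @[n --> \oo] --> alpha / b * (0 + 1).
  apply: cvgM; first exact: cvg_cst.
  apply: cvgD; last exact: cvg_cst.
  rewrite -[X in _ --> X](mulr0 (ln zeta)); apply: cvgM; first exact: cvg_cst.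
  apply/gtr0_cvgV0; last exact: ln_nat_cvgy.
  exact: (cvgry_gt (@ln_nat_cvgy R)).
rewrite add0r mulr1; apply: cvg_trans; apply: near_eq_cvg; near=> n.
have n_gt0 : 0 < (n%:R : R) by near: n; exact: (cvgry_gt cvgr_idn).
have lnn : 0 < ln (n%:R : R) by near: n; exact: (cvgry_gt (@ln_nat_cvgy R)).
rewrite lnM ?posrE // invfM; move: lnn; set y := ln n%:R => y_gt0.
have -> : 1 = y / y by rewrite mulfV // gt_eqF.
by ring.
Unshelve. all: by end_near. Qed.

Unset Implicit Arguments.
Set Strict Implicit.

Theorem mainTheorem2 (R : realType) (m C : nat) (hm : (0 < m)%N) (hC : (0 < C)%N)
    (xstar rho : R)
    (hrho : crossing_prob m C (normal_tail 0 xstar) n.+1 /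
            crossing_prob m C (normal_tail 0 xstar) n @[n --> \oo] --> rho)
    (zeta1 alpha eps : R)
    (hzeta1 : 0 < zeta1) (halpha0 : 0 < alpha) (halpha1 : alpha <= 1)
    (heps : 0 < eps)
    (L : forall n : nat, {set 'I_m * 'I_n})
    (hL : forall n : nat, (0 < n)%N -> good_chain C (L n))
    (hLlen : \forall n \near \oo, zeta1 * n%:R `^ alpha <= #|L n|%:R)
    (hLO : (fun n : nat => #|L n|%:R : R^o) =O_\oo
           (fun n : nat => zeta1 * n%:R `^ alpha : R^o))
    (mu : R) (hmu : 0 < mu)
    (d : nat -> measure_display) (T : forall n : nat, measurableType (d n))
    (P : forall n : nat, probability (T n) R)
    (X : forall n : nat, 'I_m * 'I_n -> {RV (P n) >-> R})
    (hX : forall n : nat, (0 < n)%N -> alternative mu (L n) (X n)) :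
  rho `^ (alpha * ln (zeta1 * n%:R) / ((1 + eps) * ln n%:R)) @[n --> \oo]
    --> rho `^ (alpha / (1 + eps))
  /\
  ((\forall n \near \oo,
      rho `^ (alpha * ln (zeta1 * n%:R) / ((1 + eps) * ln n%:R))
        < normal_tail mu xstar) ->
   P n [set t | (1 + eps / 2) * (ln n%:R / ln rho^-1)
                  < (longest_chain C (significant (X n) xstar t))%:R]
     @[n --> \oo] --> 1%E).
Proof.
have eps1_gt0 : 0 < 1 + eps by lra.
have rho_cvg : rho `^ (alpha * ln (zeta1 * n%:R) / ((1 + eps) * ln n%:R))
    @[n --> \oo] --> rho `^ (alpha / (1 + eps)).
  by apply: cvg_powR_exponent; [exact: divr_gt0|exact: log_ratio_cvg].
split=> // rho_lt; set q := normal_tail mu xstar in rho_lt.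
have q_gt0 : 0 < q.
  have [n] := @filter_ex _ \oo _ _ rho_lt.
  by apply: le_lt_trans; exact: powR_ge0.
(* The strict inequalities pass to the limit as a weak one. *)
have q_ge : rho `^ (alpha / (1 + eps)) <= q.
  rewrite -(cvg_lim _ rho_cvg) //; apply: limr_le.
    by apply/cvg_ex; eexists; exact: rho_cvg.
  by apply: filterS rho_lt => n /ltW.
have [/andP[rho_gt0 rho_lt1]|rho_out] := boolP (0 < rho < 1).
  have lrho : ln rho < 0 by rewrite ln_lt0 // rho_gt0.
  have q_ln : alpha / (1 + eps) * ln rho <= ln q.
    by rewrite -ln_powR ler_ln ?posrE ?powR_gt0.
  pose c := (1 + eps / 2) / ln rho^-1.
  have c_ge0 : 0 <= c.
    by rewrite /c lnV ?posrE // divr_ge0 //; lra.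
  have clnq : 0 < alpha + c * ln q.
    have := ler_wpM2l c_ge0 q_ln.
    have -> : c * (alpha / (1 + eps) * ln rho) =
              - (alpha * ((1 + eps / 2) / (1 + eps))).
      rewrite /c lnV ?posrE //; field.
      by rewrite (gt_eqF eps1_gt0) (lt_eqF lrho).
    have : (1 + eps / 2) / (1 + eps) < 1 by rewrite ltr_pdivrMr //; lra.
    by rewrite -(ltr_pM2l halpha0) mulr1; lra.
  have := longest_chain_gt_log hzeta1 c_ge0 q_gt0 clnq hL hLlen hX.
  by under eq_cvg do rewrite /c mulrAC -mulrA.
(* Outside ]0, 1[ the threshold is nonpositive (ln vanishes on nonpositive
   numbers), so one significant node is enough to exceed it. *)
have lnV_le0 : ln rho^-1 <= 0.
  have [rho_le0|rho_gt0] := leP rho 0; first by rewrite ln0 // invr_le0.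
  by rewrite ln_le0 // invf_le1 //; move: rho_out; rewrite rho_gt0 /= -leNgt.
have := longest_chain_gt_log hzeta1 (lexx 0) q_gt0 _ hL hLlen hX.
rewrite mul0r addr0 => /(_ halpha0) lb.
apply: squeeze_cvge lb (cvg_cst 1%E); near=> n.
have n_gt1 : (1 < n)%N by near: n; exact: nbhs_infty_gt.
have mE := measurable_significant (X n) xstar.
apply/andP; split; last first.
  exact: (probability_le1 _ (mE (fun S => _ < (longest_chain C S)%:R))).
apply: le_measure; rewrite ?inE.
- exact: (mE (fun S => _ < (longest_chain C S)%:R)).
- exact: (mE (fun S => _ < (longest_chain C S)%:R)).
move=> t /=; apply: le_lt_trans; rewrite mul0r.
rewrite mulr_ge0_le0 //; first by lra.
by rewrite mulr_ge0_le0 ?invr_le0 // ln_ge0 // ler1n ltnW.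
Unshelve. all: by end_near. Qed.
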